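(* Let $\mathcal{M}\in\{\mathcal{P}_n,\mathcal{B}_n,\mathcal{S}_n\}$, let $\phi$, $G$, $\operatorname{grad}$ and $\operatorname{Exp}$ be the corresponding Bregman kernel, metric tensor, Riemannian gradient and e-exponential map given in the context, let $f$ be a continuously differentiable objective function with Euclidean gradient $\partial f$, let $x\in\mathcal{M}$ and $\tau>0$. Then applying $\operatorname{Exp}_x$ to the (negative, scaled) Riemannian gradient of $f$ yields the mirror descent map and the SMART update: $$\operatorname{Exp}_x\big(-\tau\operatorname{grad} f(x)\big)=\partial\phi^{*}\big(\partial\phi(x)-\tau\,\partial f(x)\big)=\underset{z\in\mathcal{M}}{\arg\min}\Big\{\langle\partial f(x),z\rangle+\tfrac1\tau D_\phi(z,x)\Big\}=\frac{1}{Z(x)}\cdot x\cdot e^{-\tau\partial f(x)},$$ where $Z(x)=1$ if $\mathcal{M}=\mathcal{P}_n$, $Z(x)=\mathbf{1}-x+x\cdot e^{-\tau\partial f(x)}$ (a vector; componentwise division) if $\mathcal{M}=\mathcal{B}_n$, and $Z(x)=\langle x,e^{-\tau\partial f(x)}\rangle$ if $\mathcal{M}=\mathcal{S}_n$.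
   Context: Notation: $\mathbf{1}$ is the all-ones vector; $\log$, $e^{(\cdot)}$, products $x\cdot z$ and quotients $\frac{z}{x}$ of vectors are componentwise; $\langle\cdot,\cdot\rangle$ is the Euclidean inner product; $\partial$ is the Euclidean gradient; $0\log 0=0$. Manifolds: $\mathcal{P}_n=\mathbb{R}^n_{++}$ (positive orthant), $\mathcal{B}_n=(0,1)^n$, $\mathcal{S}_n=\{p\in\mathbb{R}^n: p_i>0\ \forall i,\ \langle\mathbf{1},p\rangle=1\}$, with tangent spaces $\mathbb{R}^n$, $\mathbb{R}^n$ and $T_0=\{v\in\mathbb{R}^n:\langle\mathbf{1},v\rangle=0\}$, respectively. The function $f$ is defined and continuously differentiable on an open subset of $\mathbb{R}^n$ containing $\mathcal{M}$. Metric tensors, with $\langle u,v\rangle_x=\langle u,G(x)v\rangle$ for tangent vectors $u,v$: $G(x)=\operatorname{Diag}(\mathbf{1}/x)$ for $\mathcal{P}_n$ and for $\mathcal{S}_n$ (restricted to $T_0$); $G(x)=\operatorname{Diag}\big(\mathbf{1}/(x\cdot(\mathbf{1}-x))\big)$ for $\mathcal{B}_n$. The Riemannian gradient $\operatorname{grad}f(x)$ is the tangent vector with $\langle\operatorname{grad} f(x),v\rangle_x=df(x)v$ for all tangent $v$; explicitly $\operatorname{grad} f(x)=G(x)^{-1}\partial f(x)$ for $\mathcal{P}_n,\mathcal{B}_n$ and $\operatorname{grad} f(x)=(\operatorname{Diag}(x)-xx^\top)\partial f(x)$ for $\mathcal{S}_n$. e-exponential maps, for $v$ a tangent vector at $x$: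 $\mathcal{P}_n$: $\operatorname{Exp}_x(v)=x\cdot e^{v/x}$; $\mathcal{B}_n$: $\operatorname{Exp}_x(v)=\dfrac{x\cdot e^{v/(x\cdot(\mathbf{1}-x))}}{\mathbf{1}-x+x\cdot e^{v/(x\cdot(\mathbf{1}-x))}}$; $\mathcal{S}_n$: $\operatorname{Exp}_x(v)=\dfrac{x\cdot e^{v/x}}{\langle x,e^{v/x}\rangle}$. Bregman kernels (each $+\infty$ outside the indicated domain): $\phi(x)=\langle x,\log x\rangle-\langle\mathbf{1},x\rangle$ on $\mathbb{R}^n_+$ for $\mathcal{P}_n$; $\phi(x)=\langle x,\log x\rangle+\langle\mathbf{1}-x,\log(\mathbf{1}-x)\rangle$ on $[0,1]^n$ for $\mathcal{B}_n$; $\phi(x)=\langle x,\log x\rangle$ on the probability simplex $\Delta_n$ for $\mathcal{S}_n$. For $\mathcal{S}_n$, $\partial\phi(x)$ denotes the gradient $\log x+\mathbf{1}$ of the ambient expression. $\phi^*(q)=\sup_{x\in\mathbb{R}^n}\{\langle q,x\rangle-\phi(x)\}$ is the convex conjugate (for $\mathcal{S}_n$: $\phi^*(q)=\log\langle\mathbf{1},e^q\rangle$). The Bregman divergence is $D_\phi(z,x)=\phi(z)-\phi(x)-\langle\partial\phi(x),z-x\rangle$. *)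

(* Defs.v *)
From mathcomp Require Import all_boot all_order all_algebra.
From mathcomp Require Import all_classical all_reals all_analysis.

Set Implicit Arguments.
Unset Strict Implicit.
Unset Printing Implicit Defensive.

Import Order.TTheory GRing.Theory Num.Theory.
Import numFieldNormedType.Exports.

Local Open Scope classical_set_scope.
Local Open Scope ring_scope.

Inductive manifold := Orthant | Box | Simplex.

Section Vectors.
Context {R : realType} {n : nat}.
Implicit Types u v x : 'rV[R]_n.

Definition ones : 'rV[R]_n := const_mx 1.
Definition dotv u v : R := \sum_(i < n) u 0 i * v 0 i.
Definition vmul u v : 'rV[R]_n := map2_mx (fun a b => a * b) u v.
Definition vdiv u v : 'rV[R]_n := map2_mx (fun a b => a / b) u v.
Definition vexp v : 'rV[R]_n := map_mx expR v.
(* ln is 0 at 0 (and at negative numbers), so that 0 log 0 = 0. *)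
Definition vln v : 'rV[R]_n := map_mx (@ln R) v.

Definition egrad (f : 'rV[R]_n -> R) x : 'rV[R]_n :=
  \row_(i < n) 'D_(delta_mx 0 i) f x.

Definition C1_on (U : set 'rV[R]_n) (f : 'rV[R]_n -> R) : Prop :=
  (forall x, U x -> differentiable f x) /\
  (forall x, U x -> {for x, continuous (egrad f)}).

(* g is the Euclidean gradient at q of the extended-real function F,
   which is required to be finite around q and differentiable at q. *)
Definition is_egrad (F : 'rV[R]_n -> \bar R) (q g : 'rV[R]_n) : Prop :=
  [/\ \forall p \near q, F p \is a fin_num,
      differentiable (fun p => fine (F p)) q
    & g = egrad (fun p => fine (F p)) q].

Definition conjugate (F : 'rV[R]_n -> \bar R) (q : 'rV[R]_n) : \bar R :=
  ereal_sup [set ((dotv q x)%:E - F x)%E | x in [set: 'rV[R]_n]].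

Definition argmin (A : set 'rV[R]_n) (F : 'rV[R]_n -> \bar R) :
    set 'rV[R]_n :=
  [set z | A z /\ forall y, A y -> (F z <= F y)%E].

End Vectors.

Arguments ones {R n}.

Section Geometry.
Context {R : realType} {n : nat} (M : manifold).
Implicit Types u v x z : 'rV[R]_n.

Definition points : set 'rV[R]_n :=
  match M with
  | Orthant => [set x : 'rV[R]_n | forall i, 0 < x 0 i]
  | Box => [set x : 'rV[R]_n | forall i, 0 < x 0 i < 1]
  | Simplex => [set x : 'rV[R]_n | (forall i, 0 < x 0 i) /\ dotv ones x = 1]
  end.

Definition tangent : set 'rV[R]_n :=
  match M with
  | Orthant | Box => [set: 'rV[R]_n]
  | Simplex => [set v | dotv ones v = 0]
  end.

Definition metric_tensor x : 'M[R]_n :=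
  match M with
  | Orthant | Simplex => diag_mx (vdiv ones x)
  | Box => diag_mx (vdiv ones (vmul x (ones - x)))
  end.

(* Vectors are rows: v *m (G x)^T is the row form of G(x) v. *)
Definition metric x u v : R := dotv u (v *m (metric_tensor x)^T).

Definition is_rgrad (f : 'rV[R]_n -> R) x (g : 'rV[R]_n) : Prop :=
  tangent g /\ forall v, tangent v -> metric x g v = 'd f x v.

(* The vector characterized by is_rgrad, which exists and is unique when x is
   a point of M and f is differentiable at x. *)
Definition rgrad (f : 'rV[R]_n -> R) x : 'rV[R]_n := xget 0 (is_rgrad f x).

Definition Exp x v : 'rV[R]_n :=
  match M with
  | Orthant => vmul x (vexp (vdiv v x))
  | Box =>
      let e := vexp (vdiv v (vmul x (ones - x))) in
      vdiv (vmul x e) (ones - x + vmul x e)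
  | Simplex =>
      let e := vexp (vdiv v x) in (dotv x e)^-1 *: vmul x e
  end.

Definition phi_dom : set 'rV[R]_n :=
  match M with
  | Orthant => [set x : 'rV[R]_n | forall i, 0 <= x 0 i]
  | Box => [set x : 'rV[R]_n | forall i, 0 <= x 0 i <= 1]
  | Simplex => [set x : 'rV[R]_n | (forall i, 0 <= x 0 i) /\ dotv ones x = 1]
  end.

Definition phi_expr x : R :=
  match M with
  | Orthant => dotv x (vln x) - dotv ones x
  | Box => dotv x (vln x) + dotv (ones - x) (vln (ones - x))
  | Simplex => dotv x (vln x)
  end.

Definition phi x : \bar R :=
  if x \in phi_dom then (phi_expr x)%:E else +oo%E.

(* For Orthant and Box this is the gradient of phi, points of M being
   interior to its domain; for Simplex it is, by convention, the gradient
   log x + 1 of the ambient expression. *)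
Definition phi_grad x : 'rV[R]_n := egrad phi_expr x.

Definition bregman z x : \bar R :=
  (phi z - phi x - (dotv (phi_grad x) (z - x))%:E)%E.

(* Normalization for the exponential factor e; a scalar Z is represented by
   the constant vector with value Z. *)
Definition normalizer x (e : 'rV[R]_n) : 'rV[R]_n :=
  match M with
  | Orthant => ones
  | Box => ones - x + vmul x e
  | Simplex => const_mx (dotv x e)
  end.

End Geometry.

(* Main.v *)
Require Import Defs.
From mathcomp Require Import all_boot all_order all_algebra.
From mathcomp Require Import all_classical all_reals all_analysis.
From mathcomp Require Import ring.

Set Implicit Arguments.
Unset Strict Implicit.
Unset Printing Implicit Defensive.

Import Order.TTheory GRing.Theory Num.Theory.
Import numFieldNormedType.Exports.
Local Open Scope classical_set_scope.
Local Open Scope ring_scope.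

(** Everything follows from one identity, a Fenchel-Young equality with explicit
    remainder. For each of the three manifolds there are a closed form c
    ([conj_form]) for the conjugate of the kernel and a map s ([mirror]) into
    the manifold (componentwise exponential, logistic function, softmax) such
    that, for z in the domain of
    phi and any dual vector q,
      <q, z> - phi(z) = c(q) - sum_i gap(z_i, s(q)_i)        ([fenchel_young]),
    where the last sum is the Bregman divergence of z from s(q): a sum of
    generalized relative entropies a log (a/b) - a + b, which are nonnegative
    and vanish only for a = b.

    This settles the two variational claims. Taking the supremum over z gives
    phi^* = c, attained at s(q), so that the gradient of phi^* is that of the
    explicit function c, which is s ([is_egrad_conjugate]). With
    q = grad phi(x) - tau g, the objective <g, z> + D_phi(z, x) / tau equals,
    up to a constant, (phi(z) - <q, z>) / tau, hence the sum of gaps over tau,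
    whose only minimizer is s(q) ([argmin_bregman]).

    What remains is algebra in one coordinate: since grad phi is a logarithm
    (or logit), s(grad phi(x) - g) is x e^{-g} normalized ([mirror_smart]), and
    the e-exponential of the negative Riemannian gradient is the same point
    ([Exp_smart]). On the simplex both steps rest on the invariance of the
    normalization under adding a constant to the exponent: it absorbs the
    constant 1 in grad phi and the projection onto the tangent space. *)

(** * Generalized relative entropy *)

Definition relent {R : realType} (a b : R) : R := a * (ln a - ln b) - a + b.

(** With b = a e^t this is a (e^t - 1 - t), so strict convexity of the
    exponential decides. *)
Lemma relent_gt0 (R : realType) (a b : R) :
  0 <= a -> 0 < b -> a != b -> 0 < relent a b.
Proof.
rewrite /relent le_eqVlt => /predU1P[<-|a0] b0 aNb.
  (* a = 0: the convention 0 log 0 = 0 leaves relent 0 b = b. *)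
  by rewrite mul0r oppr0 !add0r.
set t := ln b - ln a.
have tN0 : t != 0.
  by apply: contra aNb; rewrite subr_eq0 => /eqP/ln_inj->.
have bE : b = a * expR t.
  by rewrite expRB !lnK ?posrE // mulrCA divff ?mulr1 ?gt_eqF.
have -> : a * (ln a - ln b) - a + b = a * (expR t - (1 + t)).
  by rewrite [X in _ + X]bE /t; ring.
by rewrite mulr_gt0 // subr_gt0 expR_gt1Dx.
Qed.

Lemma relentxx (R : realType) (a : R) : relent a a = 0.
Proof. by rewrite /relent subrr mulr0 sub0r addNr. Qed.

Lemma relent_ge0 (R : realType) (a b : R) :
  0 <= a -> 0 < b -> 0 <= relent a b.
Proof.
move=> a0 b0; have [->|aNb] := eqVneq a b; first by rewrite relentxx.
by rewrite ltW ?relent_gt0.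
Qed.

(** * Gradients in coordinates *)

Lemma dot_ones (R : realType) (n : nat) (v : 'rV[R]_n) :
  dotv ones v = \sum_(i < n) v 0 i.
Proof. by apply: eq_bigr => i _; rewrite mxE mul1r. Qed.

Lemma dotvB (R : realType) (n : nat) (g u v : 'rV[R]_n) :
  dotv g (u - v) = dotv g u - dotv g v.
Proof.
by rewrite /dotv -sumrB; apply: eq_bigr => i _; rewrite !mxE mulrBr.
Qed.

Lemma is_diff_dotv (R : realType) (n : nat) (g x : 'rV[R]_n)
    (F : 'rV[R]_n -> R) :
  is_diff x F (dotv g) -> egrad F x = g.
Proof.
move=> [dF1 dF2]; apply/rowP => j; rewrite mxE deriveE // dF2.
rewrite /dotv (bigD1 j) //= big1 ?addr0; first by rewrite mxE !eqxx mulr1.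
by move=> i ij; rewrite mxE eqxx (negbTE ij) mulr0.
Qed.

Lemma diff_egrad (R : realType) (n : nat) (f : 'rV[R]_n -> R) (x v : 'rV[R]_n) :
  differentiable f x -> 'd f x v = dotv (egrad f x) v.
Proof.
move=> df; rewrite [in LHS](row_sum_delta v) linear_sum /=.
by apply: eq_bigr => i _; rewrite linearZ /= mxE deriveE // mulrC.
Qed.

(** The mixed form of the chain rule: the outer function is known through a
    one-variable derivative, the inner one through its differential on V. *)
Lemma is_diff_chain (R : realType) (V : normedModType R) (F dF : V -> R)
    (x : V) (h : R -> R) (d : R) :
  is_diff x F dF -> is_derive (F x) 1 h d ->
  is_diff x (h \o F) (fun v => d * dF v).
Proof.
move=> [dF1 dF2] derh.
have dh : differentiable h (F x) by apply/derivable1_diffP; apply: ex_derive.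
apply: DiffDef; first exact: differentiable_comp.
rewrite diff_comp // dF2; apply/funext => v /=.
by rewrite diff1E // derive1E derive_val mulrC.
Qed.

(** The kernels, and the conjugates on the orthant and the box, are sums of one
    scalar function over the coordinates, and the conjugate on the simplex is
    the logarithm of such a sum; this gives all the gradients. *)
Lemma is_diff_separable (R : realType) (n : nat) (x : 'rV[R]_n) (h : R -> R)
    (d : 'I_n -> R) :
  (forall i, is_derive (x 0 i) 1 h (d i)) ->
  is_diff x (fun y => \sum_(i < n) h (y 0 i)) (dotv (\row_i d i)).
Proof.
move=> dh.
have dcoord i : is_diff x (fun y : 'rV[R]_n => y 0 i) (fun v => v 0 i).
  apply: DiffDef; first exact: differentiable_coord.
  have @p : {linear 'rV[R]_n -> R}.
    by exists (fun N : 'rV[R]_n => N 0 i); do 2![eexists]; do ?[constructor];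
      rewrite ?mxE// => ? *; rewrite ?mxE//; move=> ?; rewrite !mxE.
  rewrite (_ : (fun y : 'rV[R]_n => _) = p) // diff_lin //.
  exact: coord_continuous.
rewrite (_ : (fun y => _) =
    \sum_(i < n) (h \o fun y : 'rV[R]_n => y 0 i)); last first.
  by apply/funext => y; rewrite fct_sumE.
rewrite (_ : dotv _ =
    \sum_(i < n) (fun v : 'rV[R]_n => d i * v 0 i)); last first.
  by apply/funext => y; rewrite fct_sumE; apply: eq_bigr => i _; rewrite mxE.
elim/big_rec2: _ => [|i dG G _ ih]; first exact: is_diff_cst.
by apply: is_diffD; apply: is_diff_chain.
Qed.

(** * Riemannian gradient *)

Section Metric.
Context {R : realType} {n : nat} (M : manifold).
Implicit Types (f : 'rV[R]_n -> R) (x g v : 'rV[R]_n).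

Definition weight x (i : 'I_n) : R :=
  if M is Box then (x 0 i * (1 - x 0 i))^-1 else (x 0 i)^-1.

Lemma points_gt0 x i : points M x -> 0 < x 0 i.
Proof. by case: M => /= [|/(_ i)/andP[]|[]]. Qed.

Lemma weight_gt0 x i : points M x -> 0 < weight x i.
Proof.
move=> xM; rewrite /weight; case: M xM => [xM|/(_ i)/andP[x0 x1]|[xM _]].
- by rewrite invr_gt0 (xM i).
- by rewrite invr_gt0 mulr_gt0 // subr_gt0.
- by rewrite invr_gt0.
Qed.

Lemma metricE x u v : metric M x u v = \sum_(i < n) u 0 i * v 0 i * weight x i.
Proof.
rewrite /metric /metric_tensor /weight /dotv.
by case: M; rewrite tr_diag_mx mul_mx_diag; apply: eq_bigr => i _;
  rewrite !mxE mul1r mulrA.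
Qed.

(** The difference of two candidates is tangent and orthogonal to itself for a
    positive definite metric. *)
Lemma is_rgrad_uniq f x g1 g2 :
  points M x -> is_rgrad M f x g1 -> is_rgrad M f x g2 -> g1 = g2.
Proof.
move=> xM [t1 h1] [t2 h2].
have tD : tangent M (g1 - g2).
  case: M t1 t2 => //= t1 t2.
  by rewrite dotvB t1 t2 subr0.
have := h2 _ tD; rewrite -(h1 _ tD) !metricE => /eqP.
rewrite eq_sym -subr_eq0 -sumrB psumr_eq0 => [|i _]; last first.
  rewrite -mulrBl mulr_ge0 //; last exact: ltW (weight_gt0 _ xM).
  by rewrite -mulrBl !mxE -expr2 sqr_ge0.
move/allP => h; apply/rowP => i.
have := h i; rewrite mem_index_enum => /(_ isT) /=.
rewrite -mulrBl -mulrBl !mxE mulf_eq0 (gt_eqF (weight_gt0 _ xM)) orbF.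
by rewrite mulf_eq0 orbb subr_eq0 => /eqP.
Qed.

(** The inverse metric applied to the Euclidean gradient; on the simplex,
    subtracting the x-average of the gradient first makes the result tangent,
    and the defining equation does not see this constant because tangent
    vectors have coordinate sum 0. *)
Lemma rgradE f x : points M x -> differentiable f x ->
  rgrad M f x = \row_i ((weight x i)^-1 *
    (egrad f x 0 i - if M is Simplex then dotv x (egrad f x) else 0)).
Proof.
move=> xM df.
set c := if M is Simplex then _ else _; set g := \row_i _.
have wN0 i : weight x i != 0 by rewrite gt_eqF ?weight_gt0.
suff gP : is_rgrad M f x g.
  by apply: (xget_unique _ gP) => h hP; exact: is_rgrad_uniq xM hP gP.
split=> [|v tv].
  rewrite /tangent /g /c /weight.
  case: M xM => //= -[_]; rewrite !dot_ones => x1.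
  under eq_bigr do rewrite mxE invrK mulrBr.
  by rewrite sumrB -mulr_suml x1 mul1r subrr.
rewrite metricE diff_egrad //.
have cv0 : \sum_(i < n) c * v 0 i = 0.
  rewrite -mulr_sumr -dot_ones /c.
  by case: M tv => [_|_|/= ->]; rewrite ?mul0r ?mulr0.
rewrite -[RHS]subr0 -[X in _ = _ - X]cv0 /dotv -sumrB; apply: eq_bigr => i _.
by rewrite mxE mulrAC (mulrAC _ _ (weight x i)) mulVf // mul1r mulrBl.
Qed.

End Metric.

(** * Scalar kernels and their divergences *)

Section Kernel.
Context {R : realType} (M : manifold).

Definition kernel (t : R) : R :=
  match M with
  | Orthant => t * ln t - t
  | Box => t * ln t + (1 - t) * ln (1 - t)
  | Simplex => t * ln t
  end.

Definition dkernel (t : R) : R :=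
  match M with
  | Orthant => ln t
  | Box => ln t - ln (1 - t)
  | Simplex => ln t + 1
  end.

Lemma is_derive_kernel (t : R) : 0 < t -> (M = Box -> t < 1) ->
  is_derive t 1 kernel (dkernel t).
Proof.
move=> t0 t1.
have xlnx (s : R) : 0 < s -> is_derive s 1 (fun r => r * ln r) (ln s + 1).
  move=> s0; have dln := is_derive1_ln s0.
  apply: is_derive_eq.
  by rewrite /GRing.scale /= mulfV ?gt_eqF // mulr1 addrC.
rewrite /kernel /dkernel; case: M t1 => t1; last exact: xlnx.
- by apply: (is_derive_eq (is_deriveB (xlnx _ t0) (is_derive_id t 1))); ring.
- have s0 : 0 < 1 - t by rewrite subr_gt0 t1.
  have ds := is_deriveB (is_derive_cst (1 : R) t 1) (is_derive_id t 1).
  have dxs := @is_derive1_comp _ _ (cst 1 - id) _ _ _ (xlnx _ s0) ds.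
  by apply: (is_derive_eq (is_deriveD (xlnx _ t0) dxs)); ring.
Qed.

(** The scalar Bregman divergence of [kernel]. *)
Definition gap (z s : R) : R :=
  if M is Box then relent z s + relent (1 - z) (1 - s) else relent z s.

Lemma gapxx s : gap s s = 0.
Proof. by rewrite /gap; case: M; rewrite !relentxx ?addr0. Qed.

Lemma gap_ge0 z s : 0 <= z -> 0 < s -> (M = Box -> z <= 1 /\ s < 1) ->
  0 <= gap z s.
Proof.
rewrite /gap => z0 s0.
case: M => [_|/(_ erefl)[z1 s1]|_]; try exact: relent_ge0.
by rewrite addr_ge0 ?relent_ge0 // ?subr_ge0 ?subr_gt0.
Qed.

Lemma gap_eq0 z s : 0 <= z -> 0 < s -> (M = Box -> z <= 1 /\ s < 1) ->
  gap z s = 0 -> z = s.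
Proof.
move=> z0 s0 h1 h; apply/eqP; apply: contraT => zNs.
have g0 := relent_gt0 z0 s0 zNs; suff : 0 < gap z s by rewrite h ltxx.
move: h1 {h}; rewrite /gap; case: M => // /(_ erefl)[z1 s1].
by rewrite ltr_wpDr // relent_ge0 ?subr_ge0 ?subr_gt0.
Qed.

End Kernel.

(** * Conjugate, mirror map and the Fenchel-Young equality *)

Section Conjugate.
Context {R : realType} {n : nat} (M : manifold).
Implicit Types (q x z : 'rV[R]_n).

Definition conj_form q : R :=
  match M with
  | Orthant => \sum_(i < n) expR (q 0 i)
  | Box => \sum_(i < n) ln (1 + expR (q 0 i))
  | Simplex => ln (\sum_(i < n) expR (q 0 i))
  end.

Definition mirror q : 'rV[R]_n :=
  \row_i (expR (q 0 i) / match M with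
                         | Orthant => 1
                         | Box => 1 + expR (q 0 i)
                         | Simplex => \sum_(j < n) expR (q 0 j)
                         end).

Lemma sum_expR_gt0 q z : dotv ones z = 1 -> 0 < \sum_(i < n) expR (q 0 i).
Proof.
(* The hypothesis excludes n = 0, where the sum is empty. *)
case: n q z => [q z|m q z _].
  by rewrite /dotv big_ord0 => /eqP; rewrite eq_sym oner_eq0.
by rewrite big_ord_recl ltr_pwDl ?expR_gt0 // sumr_ge0 // => i _; exact: expR_ge0.
Qed.

Lemma phi_exprE x : phi_expr M x = \sum_(i < n) kernel M (x 0 i).
Proof.
rewrite /phi_expr /kernel /dotv; case: M; rewrite -?sumrB -?big_split /=;
  by apply: eq_bigr => i _; rewrite !mxE ?mul1r.
Qed.

Lemma phi_gradE x : points M x -> phi_grad M x = \row_i dkernel M (x 0 i).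
Proof.
move=> xM; apply: is_diff_dotv.
rewrite (_ : phi_expr M = fun y => \sum_(i < n) kernel M (y 0 i)); last first.
  by apply/funext => y; exact: phi_exprE.
apply: is_diff_separable => i.
apply: is_derive_kernel; first exact: points_gt0 xM.
by move=> MB; move: xM; rewrite MB => /(_ i)/andP[].
Qed.

Lemma conj_form_diff q z : points M z -> is_diff q conj_form (dotv (mirror q)).
Proof.
move=> zM; rewrite /conj_form /mirror; case: M zM => [_|_|[_ z1]].
- apply: is_diff_separable => i; rewrite divr1; exact: is_derive_expR.
- apply: (@is_diff_separable _ _ _ (fun t : R => ln (1 + expR t))) => i.
  have e0 : 0 < 1 + expR (q 0 i) by rewrite addr_gt0 ?expR_gt0.
  have d1 := is_derive1_ln e0.
  have d2 := is_deriveD (is_derive_cst (1 : R) (q 0 i) 1)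
    (is_derive_expR (q 0 i)).
  apply: (is_derive_eq (@is_derive1_comp _ _ (cst 1 + @expR R) _ _ _ d1 d2)).
  by rewrite add0r mulrC.
- have e0 := sum_expR_gt0 q z1.
  have d0 : is_diff q (fun y : 'rV[R]_n => \sum_(i < n) expR (y 0 i)) _ :=
    is_diff_separable (fun i => is_derive_expR (q 0 i)).
  have d1 := @is_derive1_ln R _ e0.
  set g := \row_i _.
  rewrite (_ : dotv g = fun v =>
    (\sum_(i < n) expR (q 0 i))^-1 * dotv (\row_i expR (q 0 i)) v).
    exact: is_diff_chain d0 d1.
  apply/funext => v; rewrite /dotv mulr_sumr; apply: eq_bigr => i _.
  by rewrite !mxE; ring.
Qed.

(** The existence of the point z matters for the simplex with n = 0, which is
    empty. *)
Lemma mirror_points q z : points M z -> points M (mirror q).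
Proof.
rewrite /points /mirror; case: M => [_ i|_ i|[_ z1]].
- by rewrite mxE divr1 expR_gt0.
- have e0 := expR_gt0 (q 0 i).
  rewrite mxE divr_gt0 ?addr_gt0 //.
  by rewrite ltr_pdivrMr ?addr_gt0 // mul1r ltrDr ltr01.
- have e0 := sum_expR_gt0 q z1.
  split=> [i|]; first by rewrite mxE divr_gt0 ?expR_gt0.
  rewrite dot_ones; under eq_bigr do rewrite mxE.
  by rewrite -mulr_suml mulfV ?gt_eqF.
Qed.

(** The logarithm of [mirror q] is q minus a normalization: 0 on the orthant,
    log (1 + e^q) on the box, and a constant on the simplex. Substituted in the
    relative entropies this yields [conj_form]; on the orthant and the box the
    equality holds term by term, on the simplex only after summing, as z and
    [mirror q] both have coordinate sum 1. *)
Lemma fenchel_young q z : phi_dom M z ->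
  dotv q z - phi_expr M z =
  conj_form q - \sum_(i < n) gap M (z 0 i) (mirror q 0 i).
Proof.
rewrite phi_exprE /dotv /conj_form /gap /mirror /kernel.
case: M => /= [z0|z01|[z0 z1]].
- rewrite -!sumrB; apply: eq_bigr => i _.
  by rewrite mxE divr1 /relent expRK; ring.
- rewrite -!sumrB; apply: eq_bigr => i _; rewrite mxE.
  have e0 := expR_gt0 (q 0 i).
  have s0 : 0 < 1 + expR (q 0 i) by rewrite addr_gt0.
  have -> : 1 - expR (q 0 i) / (1 + expR (q 0 i)) = (1 + expR (q 0 i))^-1.
    by field; rewrite gt_eqF.
  rewrite /relent ln_div ?lnV // expRK.
  have -> : expR (q 0 i) / (1 + expR (q 0 i)) = 1 - (1 + expR (q 0 i))^-1.
    by field; rewrite gt_eqF.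
  ring.
- have e0 := sum_expR_gt0 q z1; rewrite dot_ones in z1.
  set S := \sum_(i < n) expR _ in e0 *.
  have sE : \sum_(i < n) (expR (q 0 i) / S) = 1.
    by rewrite -mulr_suml mulfV ?gt_eqF.
  have -> : \sum_(i < n) relent (z 0 i) ((\row_j (expR (q 0 j) / S)) 0 i)
      = \sum_(i < n) z 0 i * ln (z 0 i) - \sum_(i < n) q 0 i * z 0 i
      + ln S * \sum_(i < n) z 0 i - \sum_(i < n) z 0 i
      + \sum_(i < n) (expR (q 0 i) / S).
    rewrite mulr_sumr -sumrB -big_split /= -sumrB -big_split /=.
    apply: eq_bigr => i _; rewrite mxE /relent ln_div ?posrE ?expR_gt0 // expRK.
    ring.
  by rewrite sE z1; ring.
Qed.

End Conjugate.

(** * Conjugate gradient and mirror descent step *)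

Section Duality.
Context {R : realType} {n : nat} (M : manifold).
Implicit Types (f : 'rV[R]_n -> R) (q x z s g : 'rV[R]_n).

Lemma points_phi_dom z : points M z -> phi_dom M z.
Proof.
rewrite /points /phi_dom; case: M => [z0 i|z01 i|[z0 z1]]; first exact: ltW.
- by have /andP[z0 z1] := z01 i; rewrite !ltW.
- by split=> // i; exact: ltW.
Qed.

Lemma phi_dom_ge0 z i : phi_dom M z -> 0 <= z 0 i.
Proof. by case: M => /= [|/(_ i)/andP[]|[]]. Qed.

Lemma box_bounds z s i : phi_dom M z -> points M s ->
  M = Box -> z 0 i <= 1 /\ s 0 i < 1.
Proof. by case: M => // /(_ i)/andP[_ z1] /(_ i)/andP[_ s1]. Qed.

Lemma gap_coord_ge0 z s i : phi_dom M z -> points M s ->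
  0 <= gap M (z 0 i) (s 0 i).
Proof.
move=> zM sM; apply: gap_ge0.
- exact: phi_dom_ge0.
- exact: points_gt0 sM.
- exact: box_bounds.
Qed.

Lemma sum_gap_ge0 z s : phi_dom M z -> points M s ->
  0 <= \sum_(i < n) gap M (z 0 i) (s 0 i).
Proof.
by move=> zM sM; apply: sumr_ge0 => i _; exact: gap_coord_ge0.
Qed.

Lemma sum_gap_eq0 z s : phi_dom M z -> points M s ->
  \sum_(i < n) gap M (z 0 i) (s 0 i) = 0 -> z = s.
Proof.
move=> zM sM /eqP; rewrite psumr_eq0 => [/allP h|i _]; last first.
  exact: gap_coord_ge0.
apply/rowP => i; apply: (@gap_eq0 _ M).
- exact: phi_dom_ge0.
- exact: points_gt0 sM.
- exact: box_bounds.
- by apply/eqP/h; rewrite mem_index_enum.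
Qed.

Lemma phiE z : phi_dom M z -> phi M z = (phi_expr M z)%:E.
Proof. by move=> zM; rewrite /phi mem_set. Qed.

Lemma conjugateE q x : points M x -> conjugate (phi M) q = (conj_form M q)%:E.
Proof.
move=> xM; have sM := mirror_points q xM.
apply/eqP; rewrite eq_le; apply/andP; split.
  apply: ge_ereal_sup => _ [z _ <-].
  rewrite /phi; case: ifPn => [/set_mem zM|_].
    by rewrite -EFinB lee_fin fenchel_young // gerBl sum_gap_ge0.
  by rewrite leNye.
(* The supremum is attained at the mirror point, where the gaps vanish. *)
apply: ereal_sup_ubound; exists (mirror M q) => //.
rewrite phiE; last exact: points_phi_dom.
rewrite -EFinB fenchel_young; last exact: points_phi_dom.
by rewrite big1 ?subr0 // => i _; exact: gapxx.
Qed.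

Lemma is_egrad_conjugate q x :
  points M x -> is_egrad (conjugate (phi M)) q (mirror M q).
Proof.
move=> xM; have dc := conj_form_diff q xM.
have cE : (fun p : 'rV[R]_n => fine (conjugate (phi M) p)) = conj_form M.
  by apply/funext => p; rewrite (conjugateE p xM).
split; first by near=> p; rewrite (conjugateE p xM).
- by rewrite cE; case: dc.
- by rewrite cE (is_diff_dotv dc).
Unshelve. all: by end_near. Qed.

(** The terms of the objective that depend on z are tau^-1 (phi(z) - <q, z>)
    with q the argument of [mirror], so by [fenchel_young] minimizing it means
    minimizing the gaps to [mirror q]. *)
Lemma argmin_bregman g x (tau : R) : points M x -> 0 < tau ->
  argmin (points M)
    (fun z => ((dotv g z)%:E + (tau^-1)%:E * bregman M z x)%E)
  = [set mirror M (phi_grad M x - tau *: g)].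
Proof.
move=> xM tau0; set q := phi_grad M x - tau *: g.
have sM : points M (mirror M q) := mirror_points q xM.
(* K is the optimal value, the part of the objective independent of z. *)
pose K := tau^-1 * (dotv (phi_grad M x) x - phi_expr M x - conj_form M q).
have objE z : points M z ->
    ((dotv g z)%:E + (tau^-1)%:E * bregman M z x)%E =
    (K + tau^-1 * \sum_(i < n) gap M (z 0 i) (mirror M q 0 i))%:E.
  move=> zM; have zD := points_phi_dom zM.
  rewrite /bregman !phiE //; last exact: points_phi_dom.
  rewrite -!EFinB -EFinM -EFinD; congr EFin.
  have := fenchel_young q zD; set S := \sum_(i < n) _ => fy.
  have {fy} -> : S = conj_form M q - (dotv q z - phi_expr M z).
    by rewrite fy; ring.
  have -> : dotv q z = dotv (phi_grad M x) z - tau * dotv g z.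
    rewrite /q /dotv mulr_sumr -sumrB; apply: eq_bigr => i _.
    by rewrite !mxE; ring.
  by rewrite dotvB /K; field; rewrite gt_eqF.
have gap0 : \sum_(i < n) gap M (mirror M q 0 i) (mirror M q 0 i) = 0.
  by rewrite big1 // => i _; exact: gapxx.
apply/seteqP; split=> [z [zM /(_ _ sM)]|_ ->] /=.
  rewrite !objE // gap0 mulr0 addr0 lee_fin gerDl.
  rewrite pmulr_rle0 ?invr_gt0 // => le0.
  apply: (sum_gap_eq0 (points_phi_dom zM) sM).
  by apply/le_anti; rewrite le0 sum_gap_ge0 //; exact: points_phi_dom.
split=> // z zM; rewrite !objE // gap0 mulr0 addr0 lee_fin lerDl.
rewrite mulr_ge0 ?invr_ge0 ?(ltW tau0) // sum_gap_ge0 //.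
exact: points_phi_dom.
Qed.

End Duality.

(** * The multiplicative update *)

Section Update.
Context {R : realType} {n : nat} (M : manifold).
Implicit Types (f : 'rV[R]_n -> R) (x g : 'rV[R]_n).

Definition smart x (e : 'rV[R]_n) : 'rV[R]_n :=
  vmul (vdiv ones (normalizer M x e)) (vmul x e).

Lemma mirror_smart g x : points M x ->
  mirror M (phi_grad M x - g) = smart x (vexp (- g)).
Proof.
move=> xM; have x0 i := points_gt0 i xM.
rewrite phi_gradE // /mirror /smart /normalizer /dkernel.
apply/rowP => i; rewrite !mxE.
case: M xM => [_|xB|[_ x1]].
- by rewrite !mxE !divr1 mul1r expRD lnK ?posrE.
- have x1 : 0 < 1 - x 0 i by have /andP[_] := xB i; rewrite subr_gt0.
  rewrite !mxE expRD expRB !lnK ?posrE //.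
  have e0 := expR_gt0 (- g 0 i).
  by field; rewrite !gt_eqF // addr_gt0 ?mulr_gt0.
- rewrite !mxE.
  (* The constant 1 of the ambient gradient log x + 1 becomes a common factor
     e of all coordinates, which the normalization cancels. *)
  have sE j : expR ((\row_k (ln (x 0 k) + 1) - g) 0 j)
      = expR 1 * (x 0 j * expR (- g 0 j)).
    by rewrite !mxE !expRD lnK ?posrE //; ring.
  under eq_bigr do rewrite sE.
  rewrite -mulr_sumr /dotv.
  under [in RHS]eq_bigr do rewrite !mxE.
  rewrite !expRD lnK ?posrE //.
  have e1 := expR_gt0 (1 : R).
  have S0 : 0 < \sum_(j < n) x 0 j * expR (- g 0 j).
    have := sum_expR_gt0 (\row_j (ln (x 0 j) - g 0 j)) x1.
    by under eq_bigr do rewrite mxE expRD lnK ?posrE //.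
  by field; rewrite !gt_eqF.
Qed.

(** On the orthant and the box the metric factors in [Exp] and [rgrad] cancel;
    on the simplex the average subtracted in [rgrad] leaves a common factor
    e^(tau c) that drops out of the normalization. *)
Lemma Exp_smart f x (tau : R) : points M x -> differentiable f x ->
  Exp M x (- (tau *: rgrad M f x)) = smart x (vexp (- (tau *: egrad f x))).
Proof.
move=> xM df; have x0 i := points_gt0 i xM.
rewrite rgradE // /Exp /smart /normalizer /weight.
case: M xM => [_|xB|[_ x1]]; apply/rowP => i.
- rewrite !mxE invrK subr0 invr1 !mul1r; congr (_ * expR _).
  by field; rewrite gt_eqF.
- have x1 : 0 < 1 - x 0 i by have /andP[_] := xB i; rewrite subr_gt0.
  rewrite !mxE invrK subr0 mul1r mulrC.
  suff -> : - (tau * (x 0 i * (1 - x 0 i) * 'D_(delta_mx 0 i) f x)) /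
      (x 0 i * (1 - x 0 i)) = - (tau * 'D_(delta_mx 0 i) f x) by [].
  by field; rewrite !gt_eqF.
- set c := dotv x (egrad f x).
  set e := vexp (- (tau *: egrad f x)); set e' := vexp _.
  have -> : e' = expR (tau * c) *: e.
    apply/rowP => j; rewrite !mxE -expRD invrK; congr expR.
    by field; rewrite gt_eqF.
  have -> : dotv x (expR (tau * c) *: e) = expR (tau * c) * dotv x e.
    by rewrite /dotv [RHS]mulr_sumr; apply: eq_bigr => j _; rewrite mxE; ring.
  clearbody e; rewrite !mxE mul1r invfM.
  move: (dotv x e)^-1 => d; field.
  by rewrite gt_eqF ?expR_gt0.
Qed.

End Update.

Theorem proposition4p6 (R : realType) (n : nat) (M : manifold)
    (U : set 'rV[R]_n) (f : 'rV[R]_n -> R) (x : 'rV[R]_n) (tau : R)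
    (hU : open U) (hMU : points M `<=` U) (hf : C1_on U f)
    (hx : points M x) (htau : 0 < tau) :
  let e := vexp (- (tau *: egrad f x)) in
  let y := Exp M x (- (tau *: rgrad M f x)) in
  [/\ is_egrad (conjugate (phi M)) (phi_grad M x - tau *: egrad f x) y,
      argmin (points M)
        (fun z => ((dotv (egrad f x) z)%:E + (tau^-1)%:E * bregman M z x)%E)
        = [set y]
    & y = vmul (vdiv ones (normalizer M x e)) (vmul x e)].
Proof.
move=> e y.
have yE : y = smart M x e.
  by apply: Exp_smart => //; case: hf => df _; apply/df/hMU.
have yM : y = mirror M (phi_grad M x - tau *: egrad f x).
  by rewrite yE mirror_smart.
split; last exact: yE.
- by rewrite yM; exact: is_egrad_conjugate hx.
- by rewrite argmin_bregman // yM.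
Qed.
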